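(* Consider many-sorted first-order terms with a counter sort $C$ (constructors $Z:C$, $S:C\to C$), a generator sort $Y$ with no function symbols, and a carrier sort $T$, with an active-site symbol $F:T\times Y\times C\to T$ and a frame constructor $G:Y\times T\to T$. Let $\rho(x,y,n)$ be a right-hand-side term of sort $T$ whose variables are among $x:T$, $y:Y$, $n:C$ (so that $F(x,y,S(n))\to\rho(x,y,n)$ is a step rule). If $\rho(x,y,n)$ contains both an occurrence of a subterm headed by $G$ and an occurrence of a subterm headed by $F$, then $\rho(x,y,n)$ contains at least two syntactically distinct occurrences (at distinct positions) of the generator variable $y$: one as the first argument of a $G$-headed subterm and one as the second (generator) argument of an $F$-headed subterm. *)

(* Defs.v *)
From Stdlib Require List.
From mathcomp Require Import all_boot.

Set Implicit Arguments.
Unset Strict Implicit.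
Unset Printing Implicit Defensive.

Record signature (sort : Type) := Signature {
  symbol : Type;
  dom : symbol -> seq sort;
  cod : symbol -> sort
}.

Section Terms.
Variables (sort : Type) (Sg : signature sort).
Variables (X : Type) (var_sort : X -> sort).

Inductive term :=
| Var of X
| App of symbol Sg & seq term.

Inductive has_sort : term -> sort -> Prop :=
| has_sort_Var v : has_sort (Var v) (var_sort v)
| has_sort_App f ts :
    List.Forall2 has_sort ts (dom f) -> has_sort (App f ts) (cod f).

(* Positions are sequences of argument indices, counted from 0. *)
Fixpoint subterm_at (t : term) (p : seq nat) : option term :=
  match p, t with
  | [::], _ => Some t
  | i :: p', App _ ts => obind (subterm_at^~ p') (onth ts i)
  | _ :: _, Var _ => None
  end.

Definition headed_at (f : symbol Sg) (t : term) (p : seq nat) : Prop :=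
  exists ts, subterm_at t p = Some (App f ts).

Definition occurs_at (v : X) (t : term) (p : seq nat) : Prop :=
  subterm_at t p = Some (Var v).

Definition occurs_as_arg (v : X) (f : symbol Sg) (i : nat)
    (t : term) (p : seq nat) : Prop :=
  occurs_at v t p /\ exists2 p0, headed_at f t p0 & p = rcons p0 i.

End Terms.

Arguments Var {sort Sg X}.

Inductive step_sort := sC | sY | sT.

(* The signature may contain further symbols, subject only to the absence of
   symbols of result sort Y, so that every term of sort Y is a variable. *)
Record step_signature := StepSignature {
  step_sig :> signature step_sort;
  symZ : symbol step_sig;
  symS : symbol step_sig;
  symF : symbol step_sig;
  symG : symbol step_sig;
  symZ_dom : dom symZ = [::];
  symZ_cod : cod symZ = sC;
  symS_dom : dom symS = [:: sC];
  symS_cod : cod symS = sC;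
  symF_dom : dom symF = [:: sT; sY; sC];
  symF_cod : cod symF = sT;
  symG_dom : dom symG = [:: sY; sT];
  symG_cod : cod symG = sT;
  no_symbol_sY : forall f : symbol step_sig, cod f <> sY
}.

Inductive rule_var := vx | vy | vn.

Definition rule_var_sort (v : rule_var) : step_sort :=
  match v with vx => sT | vy => sY | vn => sC end.

(* Main.v *)
(* Subterms of a well-sorted term are well-sorted, and the only terms of sort
   [sY] are variables, hence [vy]: argument 0 of every [symG]-headed subterm and
   argument 1 of every [symF]-headed subterm is an occurrence of [vy]. These two
   positions differ because they end in different indices. *)
Require Import Defs.
From mathcomp Require Import all_boot.

Set Implicit Arguments.
Unset Strict Implicit.
Unset Printing Implicit Defensive.

Lemma Forall2_onthl (A B : Type) (P : A -> B -> Prop) (s : seq A) (r : seq B)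
    (i : nat) (a : A) :
  List.Forall2 P s r -> onth s i = Some a ->
  exists2 b, onth r i = Some b & P a b.
Proof.
move=> Psr; elim: Psr i => [|a' b s' r' Pab _ IH] [|i] //=; last exact: IH.
by case=> <-; exists b.
Qed.

Lemma Forall2_onthr (A B : Type) (P : A -> B -> Prop) (s : seq A) (r : seq B)
    (i : nat) (b : B) :
  List.Forall2 P s r -> onth r i = Some b ->
  exists2 a, onth s i = Some a & P a b.
Proof. by move/List.Forall2_flip; apply: Forall2_onthl. Qed.

Section SortedTerms.
Variables (sort : Type) (Sg : signature sort).
Variables (X : Type) (var_sort : X -> sort).
Implicit Types (t u : term Sg X) (s : sort) (f : symbol Sg) (p q : seq nat).

Local Notation has_sort := (has_sort var_sort).

Definition symbol_free s : Prop := forall f, cod f <> s.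

Lemma has_sort_VarP v s : has_sort (Var v : term Sg X) s <-> var_sort v = s.
Proof. by split=> [st|<-]; [inversion st | constructor]. Qed.

Lemma has_sort_AppP f ts s :
  has_sort (App f ts) s <-> List.Forall2 has_sort ts (dom f) /\ cod f = s.
Proof. by split=> [st|[? <-]]; [inversion st | constructor]. Qed.

Lemma subterm_at_cat t p q :
  subterm_at t (p ++ q) = obind (fun u => subterm_at u q) (subterm_at t p).
Proof. by elim: p t => [|i p IH] [v|f ts] //=; case: (onth ts i). Qed.

Lemma subterm_at_has_sort t s p u :
  has_sort t s -> subterm_at t p = Some u -> exists s', has_sort u s'.
Proof.
elim: p t s => [|i p IH] t s; first by move=> st [<-]; exists s.
case: t => // f ts /has_sort_AppP[ts_dom _] /=.
case ts_i: (onth ts i) => [t'|] //=.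
by have [s' _ /IH] := Forall2_onthl ts_dom ts_i; apply.
Qed.

Lemma headed_at_arg_has_sort t s f p i s' :
  has_sort t s -> headed_at f t p -> onth (dom f) i = Some s' ->
  exists2 u, subterm_at t (rcons p i) = Some u & has_sort u s'.
Proof.
move=> st [ts t_p] dom_i.
have [_ /has_sort_AppP[ts_dom _]] := subterm_at_has_sort st t_p.
have [u ts_i u_s'] := Forall2_onthr ts_dom dom_i.
by exists u => //; rewrite -cats1 subterm_at_cat t_p /= ts_i.
Qed.

Lemma symbol_free_term_Var t s :
  symbol_free s -> has_sort t s -> exists2 v, t = Var v & var_sort v = s.
Proof.
move=> s_free; case: t => [v /has_sort_VarP|f ts /has_sort_AppP[_ /s_free //]].
by exists v.
Qed.

Lemma symbol_free_arg_occurs t s f p i s' :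
  symbol_free s' -> has_sort t s -> headed_at f t p ->
  onth (dom f) i = Some s' ->
  exists2 v, var_sort v = s' & occurs_as_arg v f i t (rcons p i).
Proof.
move=> s'_free st f_p dom_i.
have [u t_pi u_s'] := headed_at_arg_has_sort st f_p dom_i.
have [v uE v_s'] := symbol_free_term_Var s'_free u_s'.
by exists v => //; split; [rewrite /occurs_at t_pi uE | exists p].
Qed.

End SortedTerms.

Lemma vy_occurs_as_arg (Sg : step_signature) (t : term Sg rule_var)
    (s : step_sort) (f : symbol Sg) (p : seq nat) (i : nat) :
  has_sort rule_var_sort t s -> headed_at f t p -> onth (dom f) i = Some sY ->
  occurs_as_arg vy f i t (rcons p i).
Proof.
move=> st f_p dom_i.
by have [[]] := symbol_free_arg_occurs (@no_symbol_sY Sg) st f_p dom_i.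
Qed.

Theorem theorem3p30 (Sg : step_signature) (rho : term Sg rule_var)
    (rho_sort : has_sort rule_var_sort rho sT)
    (has_G : exists p, headed_at (symG Sg) rho p)
    (has_F : exists p, headed_at (symF Sg) rho p) :
  exists p q : seq nat,
    [/\ p <> q,
        occurs_as_arg vy (symG Sg) 0 rho p
      & occurs_as_arg vy (symF Sg) 1 rho q].
Proof.
have [p G_p] := has_G; have [q F_q] := has_F.
exists (rcons p 0), (rcons q 1); split.
- by case/rcons_inj.
- by apply: vy_occurs_as_arg rho_sort G_p _; rewrite symG_dom.
- by apply: vy_occurs_as_arg rho_sort F_q _; rewrite symF_dom.
Qed.
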